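(* Every strictly convex Banach space $X$ satisfies (S).
   Context: A subset $A$ of a metric space $X$ is called quasi-finite if $A$ is infinite and every ball in $X$ contains only finitely many elements of $A$. A Banach space $X$ satisfies (S) (Steinhaus' property) if for any quasi-finite set $A\subset X$ there exists a dense set $Y\subset X$ such that for all $y\in Y$ and all $n\in\mathbb{N}$ (positive integers) there exists a ball $B$ (open ball) centred at $y$ with $|A\cap B|=n$. A Banach space is strictly convex if its unit sphere contains no line segment with two distinct endpoints. *)

(* Defs.v *)
From HB Require Import structures.
From mathcomp Require Import all_boot all_order all_algebra.
From mathcomp Require Import all_classical all_reals all_analysis.

Set Implicit Arguments.
Unset Strict Implicit.
Unset Printing Implicit Defensive.

Import Order.TTheory GRing.Theory Num.Theory.
Import numFieldNormedType.Exports.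

Local Open Scope classical_set_scope.
Local Open Scope card_scope.
Local Open Scope ring_scope.

(* Normed modules are not declared instances of [metricType], hence
   [pseudoMetricType]. *)
Definition quasi_finite (R : realType) (X : pseudoMetricType R) (A : set X)
    : Prop :=
  infinite_set A /\
  forall (x : X) (r : R), 0 < r -> finite_set (A `&` ball x r).

(* In a normed space, [ball y r] is the open ball [[set z | `|y - z| < r]]. *)
Definition steinhaus (R : realType) (X : completeNormedModType R) : Prop :=
  forall A : set X, quasi_finite A ->
    exists Y : set X, dense Y /\
      forall y, Y y -> forall n : nat, (0 < n)%N ->
        exists r : R, 0 < r /\ (A `&` ball y r) #= `I_n.

Definition unit_sphere (R : realType) (X : normedModType R) : set X :=
  [set x | `|x| = 1].
Arguments unit_sphere {R} X _.

Definition line_segment (R : realType) (X : normedModType R) (a b : X)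
    : set X :=
  [set (1 - t) *: a + t *: b | t in `[0, 1]].

Definition strictly_convex (R : realType) (X : normedModType R) : Prop :=
  ~ exists a b : X, a <> b /\ line_segment a b `<=` unit_sphere X.

(* Main.v *)
Require Import Defs.
From mathcomp Require Import finmap.
From mathcomp Require Import all_boot all_order all_algebra.
From mathcomp Require Import all_classical all_reals all_analysis.

(** Say that [y] separates [A] when the distances from [y] to the points of [A]
    are pairwise distinct.  If [A] is quasi-finite and [y] separates [A], then
    the points of [A] can be listed in strictly increasing order of their
    distance to [y], and the open ball centred at [y] that reaches up to the
    point number [n] (counting from 0) contains exactly [n] points of [A]
    ([exists_rank], [separating_steinhaus]).  So it is enough to find a dense
    set of separating points.

    A point fails to separate [A] exactly when it lies on the bisector
    [[set y | `|y - a| = `|y - b|]] of two distinct points of [A].  Bisectors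
    are closed, and [A], being a countable union of finite sets, gives only
    countably many of them; by the Baire category theorem the separating points
    are dense as soon as every bisector has empty interior ([dense_bisectorC],
    [dense_separating]).

    Strict convexity enters only there.  Let [y] be equidistant from [a] and
    [b], and move [y] towards [a] by a proportion [t] of the way, to [y'].  The
    distance to [a] is multiplied by [1 - t].  If the distance to [b] were too,
    then the triangle inequality for [y], [y'], [b] would be an equality; in a
    strictly convex space this puts [y'] on the segment from [y] to [b]
    ([strictly_convex_parallel]).  As [y'] is also on the segment from [y] to
    [a], at the same distance from [y], this forces [a = b]. *)

Set Implicit Arguments.
Unset Strict Implicit.
Unset Printing Implicit Defensive.

Import Order.TTheory GRing.Theory Num.Theory.
Import numFieldNormedType.Exports.

Local Open Scope classical_set_scope.
Local Open Scope card_scope.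
Local Open Scope ring_scope.

(** * Ranking the points of a set by a real function *)

Section Rank.
Variables (R : realType) (T : choiceType) (A : set T) (phi : T -> R).
Hypothesis phi_fin : forall r, finite_set (A `&` [set x | phi x < r]).

(** Only the elements of [B] below some fixed [b] in [B] compete with [b], and
    they are finitely many. *)
Lemma exists_minimizer (B : set T) : B `<=` A -> B !=set0 ->
  exists2 m, B m & forall x, B x -> phi m <= phi x.
Proof.
move=> BA [b Bb].
have finC : finite_set (B `&` [set x | phi x < phi b]).
  by apply: sub_finite_set (phi_fin (phi b)) => x [/BA].
have /finite_seqP[s Cs] := finC.
have min_seq (c : T) (l : seq T) :
    exists2 m, m \in c :: l & {in c :: l, forall x, phi m <= phi x}.
  elim: l c => [|d l IH] c.
    by exists c; rewrite ?mem_head// => x; rewrite inE => /eqP ->.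
  have [m mdl m_min] := IH d.
  have [cm|mc] := leP (phi c) (phi m).
    exists c; rewrite ?mem_head// => x; rewrite inE => /predU1P[->//|xl].
    exact: le_trans cm (m_min x xl).
  exists m; first by rewrite inE mdl orbT.
  move=> x; rewrite inE => /predU1P[->|/m_min//]; exact: ltW.
have [m mbs m_min] := min_seq b s.
have sB x : x \in s -> B x.
  by move=> xs; have : [set` s] x by []; rewrite -Cs => -[].
exists m; first by move: mbs; rewrite inE => /predU1P[->//|/sB].
move=> x Bx; have [bx|xb] := leP (phi b) (phi x).
  by apply: le_trans bx; apply: m_min; rewrite mem_head.
apply: m_min; rewrite inE; apply/orP; right.
suff : [set` s] x by [].
by rewrite -Cs.
Qed.

(** The element of rank [n.+1] is the minimizer of [phi] on what remains of [A]
    once the element [a] of rank [n] and everything below it are removed;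
    injectivity of [phi] puts [a] itself strictly below that minimizer. *)
Lemma exists_rank : infinite_set A ->
  {in A &, injective phi} -> forall n,
  exists2 a, A a & (A `&` [set x | phi x < phi a]) #= `I_n.
Proof.
move=> Ainf phi_inj; elim=> [|n [a Aa An]].
  have [m Am m_min] :=
    exists_minimizer (@subset_refl _ A) (infinite_setN0 Ainf).
  exists m => //; rewrite (_ : _ `&` _ = set0) ?II0 ?card_eqxx//.
  by apply/seteqP; split=> // x [Ax /=]; rewrite ltNge m_min.
pose L := A `&` [set x | phi x < phi a].
have Lfin : finite_set L := phi_fin (phi a).
have [m [Am /not_orP[ma mL]] m_min] :
    exists2 m, (A `\` (a |` L)) m &
      forall x, (A `\` (a |` L)) x -> phi m <= phi x.
  apply: exists_minimizer; first exact: subDsetl.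
  apply/infinite_setN0/infinite_setD => //.
  by rewrite finite_setU; split.
have am : phi a < phi m.
  rewrite lt_neqAle; apply/andP; split.
    by apply/eqP => /phi_inj aEm; apply: ma; rewrite aEm ?inE.
  by rewrite leNgt; apply/negP => ma'; apply: mL.
exists m => //.
have -> : A `&` [set x | phi x < phi m] = [set` (a |` fset_set L)%fset].
  apply/seteqP; split=> x /=; rewrite !inE in_fset_set//.
    move=> [Ax xm]; apply/orP; have [->|xa] := eqVneq x a; [by left|right].
    rewrite inE; apply: contrapT => xL.
    have : phi m <= phi x by apply: m_min; split=> // -[/eqP|//]; apply/negP.
    by rewrite leNgt xm.
  move=> /predU1P[->//|]; rewrite inE => -[Ax /= xa]; split=> //.
  exact: lt_trans am.
apply/card_eq_fsetP; rewrite cardfsU1 in_fset_set// (card_fset_set An).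
rewrite (_ : (a \in L) = false)//; apply/negP; rewrite inE => -[_ /=].
by rewrite ltxx.
Qed.

End Rank.

(** * Points at pairwise distinct distances from a quasi-finite set *)

Definition separating (R : realType) (X : normedModType R) (A : set X) : set X :=
  [set y | {in A &, injective (fun a => `|y - a|)}].

Lemma separating_steinhaus (R : realType) (X : normedModType R) (A : set X)
    (y : X) (n : nat) :
  quasi_finite A -> separating A y -> (0 < n)%N ->
  exists r : R, 0 < r /\ (A `&` ball y r) #= `I_n.
Proof.
move=> [Ainf Afin] ysep n0.
have finlt r : finite_set (A `&` [set x | `|y - x| < r]).
  have [r0|r0] := ltP 0 r; first by have := Afin y r r0; rewrite -ball_normE.
  rewrite (_ : _ `&` _ = set0)//; apply/seteqP; split=> // x [_ /=].
  by rewrite ltNge (le_trans r0).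
have [a Aa An] := exists_rank finlt Ainf ysep n.
exists `|y - a|; split; last by rewrite -ball_normE.
(* A ball of radius 0 is empty, which [0 < n] excludes. *)
rewrite lt_neqAle normr_ge0 andbT; apply/negP => /eqP ya0.
have AE : A `&` [set x | `|y - x| < `|y - a|] = set0.
  by apply/seteqP; split=> // x [_ /=]; rewrite -ya0 ltNge normr_ge0.
move: An; rewrite AE => An.
have := card_fset_set An; rewrite fset_set0 cardfs0 => n0E.
by rewrite -n0E in n0.
Qed.

Lemma quasi_finite_countable (R : realType) (X : normedModType R) (A : set X) :
  quasi_finite A -> countable A.
Proof.
move=> [_ Afin].
have -> : A = \bigcup_n (A `&` ball (0 : X) n.+1%:R).
  apply/seteqP; split=> [x Ax|x [n _ []//]].
  exists (Num.bound `|x|) => //; split=> //.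
  rewrite -ball_normE /= sub0r normrN.
  by apply: lt_trans (archi_boundP (normr_ge0 x)) _; rewrite ltr_nat.
by apply: bigcup_countable => // n _; apply/finite_set_countable/Afin.
Qed.

(** An injection [f] of [D] into [nat] turns [G] into a sequence of open dense
    sets: its term at [n] is [G i] if [n = f i] with [i] in [D], and an
    intersection over no index, hence the whole space, otherwise. *)
Lemma countable_Baire (R : realType) (X : completeNormedModType R) (I : Type)
    (D : set I) (G : I -> set X) :
  countable D -> (forall i, D i -> open (G i) /\ dense (G i)) ->
  dense (\bigcap_(i in D) G i).
Proof.
move=> /countable_injP[f f_inj] GD.
pose F n := \bigcap_(i in D `&` [set i | f i = n]) G i.
have FE i : D i -> F (f i) = G i.
  move=> Di; apply/seteqP; split=> [x /(_ i)|x Gx j [Dj /f_inj ->]]; rewrite ?inE//.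
  exact.
have odF n : open (F n) /\ dense (F n).
  have [[i [Di <-]]|noi] := pselect (exists i, D i /\ f i = n).
    by rewrite FE//; exact: GD.
  have -> : F n = setT.
    by apply/seteqP; split=> // x _ i Di; case: noi; exists i.
  by split; [exact: openT|move=> O O0 _; rewrite setIT].
move=> O O0 oO; have [x [Ox Fx]] := Baire odF O0 oO.
by exists x; split=> // i Di; rewrite -FE//; exact: Fx.
Qed.

(** * Bisectors in a strictly convex space *)

(** If [s <= t], then [s *: u + t *: v = t *: (u + v) - (t - s) *: u], whose norm
    is at least [t * (`|u| + `|v|) - (t - s) * `|u|]. *)
Lemma norm_combination (R : realType) (X : normedModType R) (u v : X) (s t : R) :
  `|u + v| = `|u| + `|v| -> 0 <= s -> 0 <= t ->
  `|s *: u + t *: v| = s * `|u| + t * `|v|.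
Proof.
wlog st : u v s t / s <= t.
  move=> H uv s0 t0; have [/H->//|/ltW ts] := leP s t.
  by rewrite addrC [RHS]addrC; apply: H; rewrite // addrC uv addrC.
move=> uv s0 t0; apply/eqP; rewrite eq_le; apply/andP; split.
  by rewrite (le_trans (ler_normD _ _))// !normrZ !ger0_norm.
have -> : s *: u + t *: v = t *: (u + v) - (t - s) *: u.
  by rewrite scalerDr scalerBl opprB [RHS]addrC addrA subrK.
apply: le_trans (lerB_dist _ _).
rewrite !normrZ uv (ger0_norm t0) ger0_norm ?subr_ge0//.
by rewrite mulrDr mulrBl opprB [leRHS]addrC addrA subrK.
Qed.

(** By [norm_combination], the segment between the unit vectors along [u] and
    [v] stays on the unit sphere. *)
Lemma strictly_convex_parallel (R : realType) (X : normedModType R) (u v : X) :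
  strictly_convex X -> u != 0 -> v != 0 -> `|u + v| = `|u| + `|v| ->
  `|u|^-1 *: u = `|v|^-1 *: v.
Proof.
move=> scX u0 v0 uv; apply: contrapT => uv_neq; apply: scX.
exists (`|u|^-1 *: u), (`|v|^-1 *: v); split=> // _ [t /= + <-].
rewrite in_itv /= => /andP[t0 t1].
rewrite /unit_sphere /= !scalerA norm_combination//; last 2 first.
- by rewrite mulr_ge0 ?subr_ge0 ?invr_ge0.
- by rewrite mulr_ge0 ?invr_ge0.
by rewrite !mulfVK ?normr_eq0// subrK.
Qed.

(** Moving from [y] towards [a], one comes closer to [a] than to any other point
    [b] at the same initial distance: the triangle inequality gives a weak
    inequality, and by [strictly_convex_parallel] equality would make the
    vectors from [y'] to [a] and to [b] equal. *)
Lemma dist_move_lt (R : realType) (X : normedModType R) (y a b : X) (t : R) :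
  strictly_convex X -> a != b -> `|y - a| = `|y - b| -> 0 < t -> t < 1 ->
  `|y + t *: (a - y) - a| < `|y + t *: (a - y) - b|.
Proof.
move=> scX ab yab t0 t1; set y' := y + t *: (a - y).
have s0 : 0 < 1 - t by rewrite subr_gt0.
have ya0 : 0 < `|y - a|.
  rewrite normr_gt0; apply: contraNneq ab => ya.
  move: yab; rewrite ya normr0 => /esym/normr0_eq0/subr0_eq <-.
  by rewrite -(subr0_eq ya).
have y'a : y' - a = (1 - t) *: (y - a).
  by rewrite /y' -[a - y]opprB scalerN scalerBl scale1r addrAC.
have yy' : y - y' = t *: (y - a).
  by rewrite /y' opprD addrA subrr sub0r -scalerN opprB.
have ny'a : `|y' - a| = (1 - t) * `|y - a| by rewrite y'a normrZ gtr0_norm.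
have nyy' : `|y - y'| = t * `|y - a| by rewrite yy' normrZ gtr0_norm.
have sum_b : (y - y') + (y' - b) = y - b by rewrite addrA subrK.
rewrite lt_neqAle; apply/andP; split; last first.
  have := ler_normD (y - y') (y' - b).
  by rewrite sum_b -yab nyy' ny'a mulrBl mul1r lerBlDl.
(* In the equality case [y - y'] and [y' - b] have the same direction, as do
   [y - y'] and [y' - a]. *)
apply/eqP => /esym ny'b.
have uv : `|(y - y') + (y' - b)| = `|y - y'| + `|y' - b|.
  by rewrite sum_b ny'b -yab nyy' ny'a -mulrDl subrKC mul1r.
have u0 : y - y' != 0 by rewrite -normr_gt0 nyy' mulr_gt0.
have v0 : y' - b != 0 by rewrite -normr_gt0 ny'b ny'a mulr_gt0.
have := strictly_convex_parallel scX u0 v0 uv.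
rewrite nyy' yy' ny'b ny'a scalerA invfM mulrAC mulVf ?gt_eqF// mul1r => par.
have y'b : y' - b = y' - a.
  rewrite y'a -[y' - b](scalerK (a := ((1 - t) * `|y - a|)^-1)); last first.
    by rewrite invr_eq0 mulf_neq0 ?gt_eqF.
  by rewrite -par scalerA invrK mulfK ?gt_eqF.
by move: ab; rewrite -(oppr_inj (addrI _ y'b)) eqxx.
Qed.

Lemma dense_bisectorC (R : realType) (X : normedModType R) (a b : X) :
  strictly_convex X -> a != b -> dense [set y : X | `|y - a| != `|y - b|].
Proof.
move=> scX ab O [y Oy] oO.
have [yab|yab] := eqVneq `|y - a| `|y - b|; last by exists y; split.
have : nbhs y O by apply: open_nbhs_nbhs; split.
move=> /nbhs_ballP[e /= e0 eO].
(* The first bound keeps the moved point within [e / 2] of [y], the second keeps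
   [t] below 1. *)
pose t := Num.min (e / 2 / (1 + `|a - y|)) 2^-1.
have d0 : 0 < 1 + `|a - y| by rewrite ltr_pwDl.
have t0 : 0 < t by rewrite lt_min !divr_gt0// invr_gt0 ltr0n.
have t1 : t < 1 by rewrite gt_min invf_lt1 ?ltr1n ?orbT.
exists (y + t *: (a - y)); split; last first.
  by rewrite /= lt_eqF// dist_move_lt.
apply: eO; rewrite -ball_normE /= opprD addrA subrr sub0r normrN normrZ gtr0_norm//.
apply: (@le_lt_trans _ _ (e / 2)); last by rewrite ltr_pdivrMr// ltr_pMr// ltr1n.
apply: (@le_trans _ _ (t * (1 + `|a - y|))).
  by rewrite ler_pM2l// lerDr.
by rewrite -ler_pdivlMr// ge_min lexx.
Qed.

Lemma open_bisectorC (R : realType) (X : normedModType R) (a b : X) :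
  open [set y : X | `|y - a| != `|y - b|].
Proof.
have cts : continuous (fun y : X => `|y - a| - `|y - b|).
  move=> y; apply: cvgB; apply: cvg_norm; apply: cvgB => //; exact: cvg_cst.
have -> : [set y : X | `|y - a| != `|y - b|] =
    (fun y : X => `|y - a| - `|y - b|) @^-1` (~` [set 0]).
  by apply/seteqP; split=> y /=; rewrite -subr_eq0 => /eqP.
apply: open_comp => [y _|]; first exact: cts.
by rewrite openC; exact: closed_eq.
Qed.

Lemma dense_separating (R : realType) (X : completeNormedModType R) (A : set X) :
  strictly_convex X -> countable A -> dense (separating A).
Proof.
move=> scX Acnt.
pose D := A `*` A `&` [set p : X * X | p.1 != p.2].
have Dcnt : countable D.
  by apply: sub_countable (countableX Acnt Acnt); apply: subset_card_le => p [].
pose G (p : X * X) := [set y : X | `|y - p.1| != `|y - p.2|].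
have dG : dense (\bigcap_(p in D) G p).
  apply: countable_Baire => // p [_ /= p12].
  by split; [exact: open_bisectorC|exact: dense_bisectorC].
move=> O O0 oO; have [y [Oy Gy]] := dG O O0 oO; exists y; split=> // a b.
rewrite !inE => Aa Ab yab; apply/eqP/negPn/negP => ab.
by have /eqP := Gy (a, b) (conj (conj Aa Ab) ab).
Qed.

Theorem corollary2 (R : realType) (X : completeNormedModType R) :
  strictly_convex X -> steinhaus X.
Proof.
move=> scX A qfA; exists (separating A); split.
  exact/dense_separating/quasi_finite_countable.
by move=> y ysep n; exact: separating_steinhaus.
Qed.
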